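(* Let $\mathbb{k}$ be a field of characteristic zero, let $q_1\in\mathbb{k}^*$ and $q_4\in\mathbb{k}$, and let $A=\sigma(\mathbb{k})\langle x,y\rangle$ be the skew PBW extension over $\mathbb{k}$ subject to the relation $$yx=q_1xy+q_4.$$ Then $A$ is a PI-algebra if and only if $q_1$ is a primitive $n$-th root of unity for some $n\ge 2$.
   Context: Here $A$ is the $\mathbb{k}$-algebra generated by $x,y$ subject to the single relation $yx=q_1xy+q_4$ (elements of $\mathbb{k}$ are central); it has $\mathbb{k}$-basis $\{x^iy^j\mid i,j\ge 0\}$. A $\mathbb{k}$-algebra $A$ is a PI-algebra if there is a polynomial $f\in\mathbb{k}\langle X_1,\dots,X_m\rangle$ in noncommuting variables which is monic (at least one of the monomials of highest total degree appearing in $f$ has coefficient $1$) and such that $f(a_1,\dots,a_m)=0$ for all $a_1,\dots,a_m\in A$.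
   Formalization: The case q_1 = 1, q_4 = 0 is excluded: there yx = xy, so A = k[x,y] is commutative and hence a PI-algebra, although 1 is not a primitive n-th root of unity for any n ≥ 2, so the claim as printed fails for that one pair of parameters. *)

(* Defs.v *)
From HB Require Import structures.
From mathcomp Require Import all_boot all_order all_algebra.
From mathcomp Require Import finmap boolp monalg.

Set Implicit Arguments.
Unset Strict Implicit.
Unset Printing Implicit Defensive.

Import GRing.Theory.
Local Open Scope ring_scope.
Local Open Scope quotient_scope.

(* The free algebra k<X_0, ..., X_(m-1)>, as the monoid algebra of the words *)
(* in m letters over k.                                                      *)
Notation free_alg k m := {malg k[{fmonom 'I_m}]}.

Section PolynomialIdentities.
Variables (k : fieldType) (m : nat).
Implicit Type f : free_alg k m.

Definition free_eval (A : algType k) (a : 'I_m -> A) f : A :=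
  \sum_(w <- msupp f) f@_w *: \prod_(i <- (w : seq 'I_m)) a i.

(* Some word of highest degree in the support has coefficient 1; this is not *)
(* monicity with respect to an order on words.                               *)
Definition free_monic f : Prop :=
  exists w : {fmonom 'I_m},
    [/\ w \in msupp f,
        forall v : {fmonom 'I_m}, v \in msupp f -> (fdeg v <= fdeg w)%N
      & f@_w = 1].

End PolynomialIdentities.

Definition PI_algebra (k : fieldType) (A : algType k) : Prop :=
  exists (m : nat) (f : free_alg k m),
    free_monic f /\ forall a : 'I_m -> A, free_eval a f = 0.

Section SkewPBW.
Variables (k : fieldType) (q1 q4 : k).

Local Notation F := (free_alg k 2).

Definition freeX : F := << fmu (ord0 : 'I_2) >>.
Definition freeY : F := << fmu (ord_max : 'I_2) >>.

Definition skew_rel : F := freeY * freeX - q1 *: (freeX * freeY) - q4%:A.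

(* The two-sided ideal generated by skew_rel. *)
Definition skew_ideal : {pred F} := fun f =>
  `[< exists s : seq (F * F), f = \sum_(p <- s) p.1 * skew_rel * p.2 >].

Lemma skew_idealP f :
  reflect (exists s : seq (F * F), f = \sum_(p <- s) p.1 * skew_rel * p.2)
          (f \in skew_ideal).
Proof. exact: asboolP. Qed.

Fact skew_ideal_zmod_closed : zmod_closed skew_ideal.
Proof.
split=> [|f g /skew_idealP[s ->] /skew_idealP[t ->]].
  by apply/skew_idealP; exists [::]; rewrite big_nil.
apply/skew_idealP; exists (s ++ [seq (- p.1, p.2) | p <- t]).
rewrite big_cat big_map /= -sumrN; congr (_ + _).
by apply: eq_bigr => p _; rewrite !mulNr.
Qed.

HB.instance Definition _ :=
  GRing.isZmodClosed.Build F skew_ideal skew_ideal_zmod_closed.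

Lemma skew_idealMl f g : g \in skew_ideal -> f * g \in skew_ideal.
Proof.
case/skew_idealP=> s ->; apply/skew_idealP; exists [seq (f * p.1, p.2) | p <- s].
by rewrite big_map mulr_sumr; apply: eq_bigr => p _; rewrite !mulrA.
Qed.

Lemma skew_idealMr f g : g \in skew_ideal -> g * f \in skew_ideal.
Proof.
case/skew_idealP=> s ->; apply/skew_idealP; exists [seq (p.1, p.2 * f) | p <- s].
by rewrite big_map mulr_suml; apply: eq_bigr => p _; exact/esym/mulrA.
Qed.

Lemma skew_rel_ideal : skew_rel \in skew_ideal.
Proof.
by apply/skew_idealP; exists [:: (1, 1)]; rewrite big_seq1 mul1r mulr1.
Qed.

(* A = k<X, Y> / (YX - q1 XY - q4). *)
Definition skewPBW : Type := Quotient.quot skew_ideal.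
HB.instance Definition _ := GRing.Zmodule.on skewPBW.

Definition skew_pi (f : F) : skewPBW := \pi_(Quotient.quot skew_ideal) f.

Lemma skew_piP f g : (skew_pi f = skew_pi g) <-> (f - g \in skew_ideal).
Proof.
rewrite /skew_pi Quotient.idealrBE; split=> [->|/eqP //]; exact: eqxx.
Qed.

Lemma skew_pi_surj (a : skewPBW) : {f | a = skew_pi f}.
Proof. by exists (repr a); rewrite /skew_pi reprK. Qed.

Fact skew_pi_is_zmod_morphism : zmod_morphism skew_pi.
Proof. by move=> f g; rewrite /skew_pi raddfB. Qed.

HB.instance Definition _ :=
  GRing.isZmodMorphism.Build F skewPBW skew_pi skew_pi_is_zmod_morphism.

(* Locked, as failed conversions between products are otherwise very slow.   *)
Fact skew_key : unit. Proof. by []. Qed.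
Definition skew_mul : skewPBW -> skewPBW -> skewPBW :=
  locked_with skew_key
    (fun a b => skew_pi (sval (skew_pi_surj a) * sval (skew_pi_surj b))).
Definition skew_scale : k -> skewPBW -> skewPBW :=
  locked_with skew_key (fun c a => skew_pi (c *: sval (skew_pi_surj a))).

Lemma skew_pi_mul f g : skew_mul (skew_pi f) (skew_pi g) = skew_pi (f * g).
Proof.
rewrite /skew_mul unlock; case: skew_pi_surj => f' /= /skew_piP If.
case: skew_pi_surj => g' /= /skew_piP Ig; apply/esym/skew_piP.
have -> : f * g - f' * g' = (f - f') * g + f' * (g - g').
  by rewrite mulrBl mulrBr addrA subrK.
by apply: rpredD; [apply: skew_idealMr | apply: skew_idealMl].
Qed.

Lemma skew_pi_scale c f : skew_scale c (skew_pi f) = skew_pi (c *: f).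
Proof.
rewrite /skew_scale unlock; case: skew_pi_surj => f' /= /skew_piP If.
by apply/esym/skew_piP; rewrite -scalerBr -mul_malgC skew_idealMl.
Qed.

(* The ideal is proper: k<X, Y> acts on sequences v : nat -> k, seen as      *)
(* power series, X by multiplication by t and Y by the q1-derivative times   *)
(* q4, and skew_rel acts by zero.                                            *)
Let qint n : k := \sum_(i < n) q1 ^+ i.
Let actX (v : nat -> k) n := if n is n'.+1 then v n' else 0.
Let actY (v : nat -> k) n := qint n.+1 * q4 * v n.+1.
Let act1 (i : 'I_2) := if i == ord0 then actX else actY.
Let actw (w : {fmonom 'I_2}) v : nat -> k := foldr act1 v (w : seq 'I_2).
Let act (f : F) v n := mmap idfun (fun w => actw w v n) f.

Let actD f g v n : act (f + g) v n = act f v n + act g v n.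
Proof. exact: raddfD. Qed.
Let actN f v n : act (- f) v n = - act f v n.
Proof. exact: raddfN. Qed.
Let actU c w v n : act << c *g w >> v n = c * actw w v n.
Proof. exact: mmapU. Qed.

Let act1_ext i u v : u =1 v -> act1 i u =1 act1 i v.
Proof.
move=> e n; rewrite /act1 /actX /actY; case: ifP => _; last by rewrite e.
by case: n => [|n].
Qed.

Let actw_ext w u v : u =1 v -> actw w u =1 actw w v.
Proof. by case: w => s e; rewrite /actw /=; elim: s => //= i s /act1_ext. Qed.

Let act1_0 i n : act1 i (fun=> 0) n = 0.
Proof.
rewrite /act1 /actX /actY; case: ifP => _; last by rewrite mulr0.
by case: n => [|n].
Qed.

Let malgZU c w : c *: (<< w >> : F) = << c *g w >>.
Proof. by apply/malgP=> u; rewrite [LHS]mcoeffZ !mcoeffU mulr_natr. Qed.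

Let act_rel v n : act skew_rel v n = 0.
Proof.
have -> : skew_rel = << mmul (fmu ord_max) (fmu ord0) >>
    - << q1 *g mmul (fmu ord0) (fmu ord_max) >> - << q4 *g mone >>.
  rewrite /skew_rel /freeX /freeY !malgM_def !fgmulUU mulr1.
  by rewrite (malgZU q1) (malgZU q4).
rewrite [LHS]actD [X in X + _]actD [X in _ + X + _]actN [X in _ + X]actN.
rewrite 3!actU /actw !fmM !fmU fm1 /= /act1 /= /actX /actY.
rewrite /qint big_ord_recl expr0 /= mul1r !mulrDl mul1r.
have -> : \sum_(i < n) q1 ^+ bump 0 i = q1 * \sum_(i < n) q1 ^+ i.
  by rewrite mulr_sumr; apply: eq_bigr => i _; rewrite exprS.
case: n => [|n]; first by rewrite big_ord0 !mulr0 !mul0r addr0 subr0 subrr.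
by rewrite [_ + _ - _]addrAC -!mulrA addrAC addrK subrr.
Qed.

Let act_sum I (s : seq I) (G : I -> F) v n :
  act (\sum_(i <- s) G i) v n = \sum_(i <- s) act (G i) v n.
Proof. exact: raddf_sum. Qed.

Let actw_sum I (s : seq I) (c : I -> k) (G : I -> nat -> k) w n :
  actw w (fun n => \sum_(i <- s) c i * G i n) n
    = \sum_(i <- s) c i * actw w (G i) n.
Proof.
case: w => w; elim: w n => //= j w IHw n.
rewrite /actw /= in IHw *; rewrite /act1 /actX /actY; case: ifP => _.
  by case: n => [|n]; [rewrite big1 // => i _; rewrite mulr0 | exact: IHw].
by rewrite IHw mulr_sumr; apply: eq_bigr => i _; rewrite mulrCA.
Qed.

Let actMr c w f v n : act (f * << c *g w >>) v n = c * act f (actw w v) n.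
Proof.
rewrite malgM_def fgmulgU act_sum /act [in RHS]mmapE mulr_sumr.
apply: eq_bigr => u _; rewrite [LHS]actU mulrA [c * _]mulrC; congr (_ * _).
by rewrite /actw fmM foldr_cat.
Qed.

Let actMl c w f v n : act (<< c *g w >> * f) v n = c * actw w (act f v) n.
Proof.
rewrite malgM_def fgmulUg act_sum.
rewrite (_ : actw w _ n = \sum_(u <- msupp f) f@_u * actw w (actw u v) n).
  rewrite mulr_sumr; apply: eq_bigr => u _; rewrite actU mulrA; congr (_ * _).
  by rewrite /actw fmM foldr_cat.
by rewrite -actw_sum; apply: actw_ext => j.
Qed.

Let actw0 w n : actw w (fun=> 0) n = 0.
Proof.
case: w => w; rewrite /actw /=; elim: w n => //= i w IHw n.
by rewrite (act1_ext _ IHw) act1_0.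
Qed.

Let act_ideal f v n : f \in skew_ideal -> act f v n = 0.
Proof.
case/skew_idealP=> s ->; rewrite act_sum big1 // => -[f1 f2] _ /=.
rewrite [f2]monalgE mulr_sumr act_sum big1 // => w _; rewrite actMr.
rewrite [f1]monalgE mulr_suml act_sum big1 ?mulr0 // => u _.
by rewrite actMl (actw_ext _ (act_rel _)) actw0 mulr0.
Qed.

Fact skew_ideal_proper : 1 \notin skew_ideal.
Proof.
apply/negP=> /(act_ideal (fun=> 1) 0) /eqP.
by rewrite actU /actw fm1 mulr1 oner_eq0.
Qed.

Fact skew_mulA : associative skew_mul.
Proof.
move=> a b c; have [f ->] := skew_pi_surj a; have [g ->] := skew_pi_surj b.
by have [h ->] := skew_pi_surj c; rewrite !skew_pi_mul mulrA.
Qed.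

Fact skew_mul1r : left_id (skew_pi 1) skew_mul.
Proof.
by move=> a; have [f ->] := skew_pi_surj a; rewrite skew_pi_mul mul1r.
Qed.

Fact skew_mulr1 : right_id (skew_pi 1) skew_mul.
Proof.
by move=> a; have [f ->] := skew_pi_surj a; rewrite skew_pi_mul mulr1.
Qed.

Fact skew_mulrDl : left_distributive skew_mul +%R.
Proof.
move=> a b c; have [f ->] := skew_pi_surj a; have [g ->] := skew_pi_surj b.
have [h ->] := skew_pi_surj c.
by rewrite -raddfD !skew_pi_mul mulrDl raddfD.
Qed.

Fact skew_mulrDr : right_distributive skew_mul +%R.
Proof.
move=> a b c; have [f ->] := skew_pi_surj a; have [g ->] := skew_pi_surj b.
have [h ->] := skew_pi_surj c.
by rewrite -raddfD !skew_pi_mul mulrDr raddfD.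
Qed.

Fact skew_oner_neq0 : skew_pi 1 != 0.
Proof.
apply/eqP; rewrite -(raddf0 skew_pi) => /skew_piP; rewrite subr0.
exact/negP/skew_ideal_proper.
Qed.

HB.instance Definition _ := GRing.Zmodule_isNzRing.Build skewPBW
  skew_mulA skew_mul1r skew_mulr1 skew_mulrDl skew_mulrDr skew_oner_neq0.

Lemma skew_pi1 : skew_pi 1 = 1.
Proof. by []. Qed.

Lemma skew_piM f g : skew_pi (f * g) = skew_pi f * skew_pi g.
Proof. exact/esym/skew_pi_mul. Qed.

Fact skew_scalerA c d a : skew_scale c (skew_scale d a) = skew_scale (c * d) a.
Proof.
by have [f ->] := skew_pi_surj a; rewrite !skew_pi_scale scalerA.
Qed.

Fact skew_scale1r : left_id 1 skew_scale.
Proof.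
by move=> a; have [f ->] := skew_pi_surj a; rewrite skew_pi_scale scale1r.
Qed.

Fact skew_scalerDr : right_distributive skew_scale +%R.
Proof.
move=> c a b; have [f ->] := skew_pi_surj a; have [g ->] := skew_pi_surj b.
by rewrite -raddfD !skew_pi_scale scalerDr raddfD.
Qed.

Fact skew_scalerDl a : {morph skew_scale^~ a : c d / c + d}.
Proof.
move=> c d; have [f ->] := skew_pi_surj a.
by rewrite !skew_pi_scale scalerDl raddfD.
Qed.

HB.instance Definition _ := GRing.Zmodule_isLmodule.Build k skewPBW
  skew_scalerA skew_scale1r skew_scalerDr skew_scalerDl.

Lemma skew_piZ c f : skew_pi (c *: f) = c *: skew_pi f.
Proof. exact/esym/skew_pi_scale. Qed.

Fact skew_scalerAl (c : k) (a b : skewPBW) : c *: (a * b) = (c *: a) * b.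
Proof.
have [f ->] := skew_pi_surj a; have [g ->] := skew_pi_surj b.
by rewrite -skew_piM -!skew_piZ -skew_piM scalerAl.
Qed.

HB.instance Definition _ :=
  GRing.Lmodule_isLalgebra.Build k skewPBW skew_scalerAl.

Fact free_scalerAr (c : k) (f g : F) : c *: (f * g) = f * (c *: g).
Proof.
apply/malgP=> w.
rewrite [LHS]mcoeffZ mcoeffMl [RHS](mcoeffMlw _ (fsubset_refl _) (msuppZ_le _ _)).
rewrite mulr_sumr; apply: eq_bigr => u _; rewrite mulr_sumr; apply: eq_bigr => v _.
by rewrite mcoeffZ mulrnAr mulrCA.
Qed.

Fact skew_scalerAr (c : k) (a b : skewPBW) : c *: (a * b) = a * (c *: b).
Proof.
have [f ->] := skew_pi_surj a; have [g ->] := skew_pi_surj b.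
by rewrite -skew_piM -!skew_piZ -skew_piM free_scalerAr.
Qed.

HB.instance Definition _ :=
  GRing.Lalgebra_isAlgebra.Build k skewPBW skew_scalerAr.

Definition skewX : skewPBW := skew_pi freeX.
Definition skewY : skewPBW := skew_pi freeY.

Lemma skewYX : skewY * skewX = q1 *: (skewX * skewY) + q4%:A.
Proof.
rewrite /skewX /skewY -!skew_piM -skew_piZ -skew_pi1 -skew_piZ -raddfD.
by apply/skew_piP; rewrite opprD addrA; exact: skew_rel_ideal.
Qed.

End SkewPBW.

(* Main.v *)
From HB Require Import structures.
Require Import Defs.
From mathcomp Require Import all_boot all_order all_algebra.
From mathcomp Require Import perm finmap boolp functions monalg.

Import GRing.Theory.
Local Open Scope ring_scope.

Set Implicit Arguments.
Unset Strict Implicit.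
Unset Printing Implicit Defensive.

(** Write [x] and [y] for the generators of [A], so [y x = q1 x y + q4].

    Suppose that [q1] is a primitive [n]-th root of unity with [n >= 2]. Then
    [y x^n = q1^n x^n y + (1 + q1 + ... + q1^(n-1)) q4 x^(n-1) = x^n y], and
    similarly for [y^n], so [x^n] and [y^n] are central. The [n^2] monomials
    [x^i y^j] with [i, j < n] therefore span [A] over its centre
    ([skewPBW_spanned]). The standard polynomial in [n^2 + 1] variables is
    alternating and multilinear over the centre, so it vanishes on any algebra
    spanned by [n^2] elements over its centre ([central_span_PI]).

    Conversely, suppose that [q1] is not such a root of unity. Let [c] be a
    sequence indexed by [int] with [c (n + 1) = q1 * c n + q4]. The algebra acts
    on a space with vectors [e n] by [x e_n = e_(n+1)] and
    [y e_n = c_n e_(n-1)], and [x y] is then diagonal with eigenvalue [c n] on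
    [e n]. The sequence can be chosen so that the [c n] with [n] natural are
    pairwise distinct ([weights_exist]): take [c n = q1^n + q4 / (1 - q1)] if
    [q1 != 1], and [c n = n q4] if [q1 = 1], where characteristic zero and
    [q4 != 0] are used. Polynomials in [x y] now separate the levels [e n].
    Given a polynomial [f] with a word [w] of length [d] in its support,
    substitute for the letter [i] the element
    [a_i = x * \prod_p (x y - c p)], where [p] runs over the levels below [d]
    at which [w] does not have the letter [i]. Every [a_i] climbs one level, so
    a word of length [d] sends [e 0] to a multiple of [e d], and this multiple
    is nonzero for the word [w] and zero for any other word of length [d].
    Hence the [e d] coordinate of [f(a) e_0] is nonzero, and [f] is not an
    identity of [A] ([skew_not_PI]). *)

(** * Extension by linearity and actions of the free algebra *)

Section LinearExtension.
Variables (K : choiceType) (k : fieldType) (V : lmodType k) (h : K -> V).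

(** Evaluation of noncommutative polynomials and the action of the free algebra
    on a module are both instances of this extension by linearity, so their
    additivity is proved once. *)
Definition lin_ext (g : {malg k[K]}) : V := \sum_(x <- msupp g) g@_x *: h x.

Lemma lin_extEw (D : {fset K}) g : fsubset (msupp g) D ->
  lin_ext g = \sum_(x <- D) g@_x *: h x.
Proof.
move=> le; rewrite [LHS](big_fset_incl _ le) => //= x xd /mcoeff_outdom ->.
by rewrite scale0r.
Qed.

Fact lin_ext_is_linear : linear lin_ext.
Proof.
move=> c f g.
pose D := fsetU (msupp (c *: f + g)) (fsetU (msupp f) (msupp g)).
rewrite !(@lin_extEw D) ?fsubsetUl //; last first.
- by rewrite /D fsetUCA fsubsetUl.
- by rewrite /D (fsetUC (msupp f)) fsetUCA fsubsetUl.
rewrite scaler_sumr -big_split; apply: eq_bigr => x _ /=.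
by rewrite scalerA -scalerDl mcoeffD mcoeffZ.
Qed.

HB.instance Definition _ :=
  GRing.isLinear.Build k {malg k[K]} V *:%R lin_ext lin_ext_is_linear.

Lemma lin_extU c x : lin_ext << c *g x >> = c *: h x.
Proof. by rewrite (lin_extEw msuppU_le) big_seq_fset1 mcoeffUU. Qed.

End LinearExtension.

Lemma malgUZ (K : choiceType) (k : fieldType) (c : k) (x : K) :
  << c *g x >> = c *: << x >> :> {malg k[K]}.
Proof. by apply/malgP=> u; rewrite [RHS]mcoeffZ !mcoeffU mulr_natr. Qed.

Section Words.
Variables (k : fieldType) (m : nat).
Local Notation F := {malg k[{fmonom 'I_m}]}.

Lemma free_eval_lin_ext (A : algType k) (a : 'I_m -> A) f :
  free_eval a f =
    lin_ext (fun w : {fmonom 'I_m} => \prod_(i <- (w : seq 'I_m)) a i) f.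
Proof. by []. Qed.

Section Action.
Variables (V : lmodType k) (T : 'I_m -> {linear V -> V}).

Definition word_act (w : seq 'I_m) (v : V) : V := foldr (fun i => T i) v w.

Fact word_act_is_linear w : linear (word_act w).
Proof. by move=> c u v; elim: w => //= i w ->; rewrite linearP. Qed.

HB.instance Definition _ w :=
  GRing.isLinear.Build k V V *:%R (word_act w) (word_act_is_linear w).

Definition free_act (f : F) (v : V) : V :=
  lin_ext (fun w : {fmonom 'I_m} => word_act w v) f.

Lemma free_actU c (w : {fmonom 'I_m}) v :
  free_act << c *g w >> v = c *: word_act w v.
Proof. exact: lin_extU. Qed.

Fact free_act_is_linear f : linear (free_act f).
Proof.
move=> c u v; rewrite /free_act /lin_ext scaler_sumr -big_split.
by apply: eq_bigr => w _; rewrite linearP scalerDr !scalerA mulrC.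
Qed.

HB.instance Definition _ f :=
  GRing.isLinear.Build k V V *:%R (free_act f) (free_act_is_linear f).

Lemma free_act1 v : free_act 1 v = v.
Proof. by rewrite free_actU scale1r fm1. Qed.

Lemma free_actD f g v : free_act (f + g) v = free_act f v + free_act g v.
Proof. exact: linearD. Qed.

Lemma free_actB f g v : free_act (f - g) v = free_act f v - free_act g v.
Proof. exact: linearB. Qed.

Lemma free_actZ c f v : free_act (c *: f) v = c *: free_act f v.
Proof. exact: linearZ. Qed.

Lemma free_act_sum I (r : seq I) (G : I -> F) v :
  free_act (\sum_(i <- r) G i) v = \sum_(i <- r) free_act (G i) v.
Proof. exact: linear_sum. Qed.

Lemma free_actM f g v : free_act (f * g) v = free_act f (free_act g v).
Proof.
rewrite malgME free_act_sum; apply: eq_bigr => u _.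
rewrite free_act_sum [free_act g v]/lin_ext linear_sum scaler_sumr.
apply: eq_bigr => w _; rewrite free_actU linearZ /= scalerA; congr (_ *: _).
by rewrite fmM /word_act foldr_cat.
Qed.

(** Stated for arbitrary [x] and [y], since the concrete generators of the free
    algebra are expensive to compare up to conversion. *)
Lemma free_act_rel x y (q c : k) v :
  free_act (y * x - q *: (x * y) - c%:A) v =
  free_act y (free_act x v) - q *: free_act x (free_act y v) - c *: v.
Proof.
rewrite 2!free_actB; congr (_ - _ - _); first exact: free_actM.
  by rewrite free_actZ free_actM.
by rewrite free_actZ free_act1.
Qed.

End Action.
End Words.

Section SkewModule.
Variables (k : fieldType) (q1 q4 : k) (V : lmodType k) (S T : {linear V -> V}).
Hypothesis TS : forall v, T (S v) = q1 *: S (T v) + q4 *: v.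

Local Notation A := (skewPBW q1 q4).
Let gen (i : 'I_2) : {linear V -> V} := if i == ord0 then S else T.

Let free_actX v : free_act gen (freeX k) v = S v.
Proof. by rewrite free_actU fmU /= scale1r. Qed.

Let free_actY v : free_act gen (freeY k) v = T v.
Proof. by rewrite free_actU fmU /= scale1r. Qed.

(** [TS] makes [skew_rel] act by zero, and what acts by zero generates a
    two-sided ideal that acts by zero. *)
Let free_act_ideal f v : f \in skew_ideal q1 q4 -> free_act gen f v = 0.
Proof.
case/skew_idealP=> s ->; rewrite free_act_sum big1 // => -[f1 f2] _ /=.
rewrite !free_actM; set u := free_act gen f2 v.
suff -> : free_act gen (skew_rel q1 q4) u = 0 by rewrite linear0.
rewrite [LHS]free_act_rel !free_actX !free_actY TS.
by rewrite addrAC addrK subrr.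
Qed.

(** The module over [A] defined by a pair of operators satisfying the relation;
    it is how elements of the quotient [A] are shown to be nonzero. *)
Definition skew_act (a : A) : V -> V := free_act gen (sval (skew_pi_surj a)).

Lemma skew_act_pi f v : skew_act (skew_pi q1 q4 f) v = free_act gen f v.
Proof.
rewrite /skew_act; case: skew_pi_surj => g /= /skew_piP fg.
have := free_act_ideal v fg.
by rewrite free_actB => /eqP; rewrite subr_eq0 => /eqP.
Qed.

Fact skew_act_is_linear a : linear (skew_act a).
Proof. exact: free_act_is_linear. Qed.

HB.instance Definition _ a :=
  GRing.isLinear.Build k V V *:%R (skew_act a) (skew_act_is_linear a).

Lemma skew_actP v : linear (skew_act^~ v).
Proof.
move=> c a b; have [f ->] := skew_pi_surj a; have [g ->] := skew_pi_surj b.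
by rewrite -skew_piZ -raddfD !skew_act_pi free_actD free_actZ.
Qed.

Lemma skew_act0 v : skew_act 0 v = 0.
Proof. by have := skew_actP v (-1) 0 0; rewrite scaler0 addr0 scaleN1r addNr. Qed.

Lemma skew_act_sum I (r : seq I) (z : I -> k) (a : I -> A) v :
  skew_act (\sum_(i <- r) z i *: a i) v = \sum_(i <- r) z i *: skew_act (a i) v.
Proof.
elim: r => [|i r IHr]; first by rewrite !big_nil skew_act0.
by rewrite !big_cons skew_actP IHr.
Qed.

Lemma skew_actM a b v : skew_act (a * b) v = skew_act a (skew_act b v).
Proof.
have [f ->] := skew_pi_surj a; have [g ->] := skew_pi_surj b.
by rewrite -skew_piM !skew_act_pi free_actM.
Qed.

Lemma skew_act1 v : skew_act 1 v = v.
Proof. by rewrite -skew_pi1 skew_act_pi free_actU fm1 scale1r. Qed.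

Lemma skew_actX v : skew_act (skewX q1 q4) v = S v.
Proof. by rewrite skew_act_pi free_actX. Qed.

Lemma skew_actY v : skew_act (skewY q1 q4) v = T v.
Proof. by rewrite skew_act_pi free_actY. Qed.

End SkewModule.

(** * Weighted shifts and the absence of identities *)

Section WeightedShifts.
Variables (k : fieldType) (q1 q4 : k) (c : int -> k).
Hypothesis cS : forall n : int, c (n + 1) = q1 * c n + q4.
Hypothesis c_inj : injective (fun n : nat => c n%:Z).

Local Notation V := (int -> k^o).
Local Notation A := (skewPBW q1 q4).

(** [raising] and [lowering] model [x] and [y]; on the vectors [e n] below they
    are [e n |-> e (n + 1)] and [e n |-> c n *: e (n - 1)]. Indexing by all of
    [int] leaves [c 0] free, so that one family of modules covers both the
    quantum plane ([q4 = 0]) and the quantum Weyl algebras: on the indices in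
    [nat], [lowering] would need [c 0 = 0]. *)
Definition raising (v : V) : V := fun n => v (n - 1).
Definition lowering (v : V) : V := fun n => c (n + 1) * v (n + 1).

Fact raising_is_linear : linear raising.
Proof. by []. Qed.
Fact lowering_is_linear : linear lowering.
Proof.
move=> a u v; apply/funext=> n; rewrite /lowering.
by rewrite [LHS]mulrDr [RHS]/GRing.add /=; congr (_ + _); exact: mulrCA.
Qed.

HB.instance Definition _ :=
  GRing.isLinear.Build k V V *:%R raising raising_is_linear.
HB.instance Definition _ :=
  GRing.isLinear.Build k V V *:%R lowering lowering_is_linear.

Lemma lowering_raising v :
  lowering (raising v) = q1 *: raising (lowering v) + q4 *: v.
Proof.
apply/funext=> n; rewrite /lowering /raising addrK.
by rewrite [RHS]/GRing.add /GRing.scale /= /GRing.scale /= subrK cS mulrDl mulrA.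
Qed.

Local Notation rho := (@skew_act k q1 q4 V raising lowering).

Definition basis_vec (n : nat) : V := fun m => (m == n%:Z)%:R.
Local Notation e := basis_vec.

Lemma raising_basis n : raising (e n) = e n.+1.
Proof. by apply/funext=> m; rewrite /raising /e subr_eq -PoszD addn1. Qed.

Definition weight_op : A := skewX q1 q4 * skewY q1 q4.

Lemma raising_lowering v n : raising (lowering v) n = c n * v n.
Proof. by rewrite /raising /lowering subrK. Qed.

Lemma weight_opE n : rho weight_op (e n) = c n%:Z *: e n.
Proof.
rewrite /weight_op (skew_actM lowering_raising) (skew_actX lowering_raising).
rewrite (skew_actY lowering_raising); apply/funext=> m.
rewrite [LHS]raising_lowering /e [RHS]/GRing.scale /= [RHS]/GRing.scale /=.
by case: eqP => [->|]; rewrite ?mulr0.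
Qed.

Lemma weight_prodE (r : seq nat) (P : pred nat) n :
  rho (\prod_(p <- r | P p) (weight_op - (c p%:Z)%:A)) (e n) =
  \prod_(p <- r | P p) (c n%:Z - c p%:Z) *: e n.
Proof.
elim: r => [|p r IHr]; first by rewrite !big_nil (skew_act1 lowering_raising) scale1r.
rewrite !big_cons; case: ifP => // _; rewrite (skew_actM lowering_raising) IHr linearZ /=.
rewrite mulrC -scalerA; congr (_ *: _).
rewrite addrC -scaleNr (skew_actP lowering_raising) weight_opE.
by rewrite (skew_act1 lowering_raising) -scalerDl addrC.
Qed.

Section Separation.
Variables (m : nat) (w : seq 'I_m).

(** Vanishes at the weight [c p] of every level [p] whose letter in [w] differs
    from [o]. Levels are counted from the right end of a word, because in a
    product the rightmost factor acts first; hence the reversals. Letters are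
    compared as options, so that an empty alphabet needs no default letter. *)
Definition letter_weight (o : option 'I_m) (z : k) : k :=
  \prod_(p <- iota 0 (size w) | onth (rev w) p != o) (z - c p%:Z).

(** Since [weight_op] has eigenvalue [c n] on [e n], this element sends [e n] to
    [letter_weight (Some i) (c n) *: e n.+1]: it climbs one level, and dies at
    the levels of [w] that carry a letter other than [i]. *)
Definition word_detector (i : 'I_m) : A :=
  skewX q1 q4 *
  \prod_(p <- iota 0 (size w) | onth (rev w) p != Some i)
    (weight_op - (c p%:Z)%:A).

Definition word_weight (v : seq 'I_m) : k :=
  \prod_(j < size v) letter_weight (onth (rev v) j) (c j%:Z).

Lemma word_detectorE v :
  rho (\prod_(i <- v) word_detector i) (e 0) = word_weight v *: e (size v).
Proof.
rewrite /word_weight; elim: v => [|i v IHv].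
  by rewrite big_nil big_ord0 (skew_act1 lowering_raising) scale1r.
rewrite big_cons (skew_actM lowering_raising) IHv linearZ /=.
rewrite big_ord_recr -scalerA /=.
rewrite /word_detector (skew_actM lowering_raising) weight_prodE linearZ /=.
rewrite (skew_actX lowering_raising) [X in _ *: (_ *: X)]raising_basis.
congr (_ *: (_ *: _)).
  apply: eq_bigr => j _; rewrite rev_cons -cats1 onth_cat size_rev.
  by rewrite ltn_ord.
by rewrite /letter_weight rev_cons -cats1 onth_cat size_rev ltnn subnn.
Qed.

(** The factors left in [letter_weight] at level [j] belong to levels [p] with
    another letter, so [p != j] and [c j - c p] is nonzero. *)
Lemma word_weight_neq0 : word_weight w != 0.
Proof.
apply/prodf_neq0 => j _; rewrite /letter_weight prodf_seq_neq0; apply/allP=> p _.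
apply/implyP=> wpj; rewrite subr_eq0.
by apply: contra wpj => /eqP/c_inj ->.
Qed.

(** At a level [j] where the letters of [v] and [w] differ, [c j - c j] is one
    of the factors. *)
Lemma word_weight_eq0 v : size v = size w -> v != w -> word_weight v = 0.
Proof.
move=> vw neq_vw; apply/eqP/prodf_eq0.
have [/existsP[j neq_j]|] :=
    boolP [exists j : 'I_(size v), onth (rev w) j != onth (rev v) j].
  exists j => //; rewrite /letter_weight prodf_seq_eq0; apply/hasP.
  by exists (j : nat); rewrite ?mem_iota -?vw ?ltn_ord //= neq_j subrr eqxx.
rewrite negb_exists => /forallP eq_vw; case/eqP: neq_vw.
apply: (can_inj revK); apply: eq_from_onth_le => j; rewrite !size_rev -vw maxnn => jv.
by apply/esym/eqP; rewrite -[_ == _]negbK (eq_vw (Ordinal jv)).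
Qed.

End Separation.

(** Each word [v] of [f] contributes a multiple of [e (size v)], so the
    coordinate of index [size w] sees only the words as long as [w], and of
    these only [w] itself survives. *)
Lemma skew_not_PI : ~ PI_algebra A.
Proof.
case=> m [f [[w [w_f _ fw1]] /(_ (word_detector w)) f0]].
have: rho (free_eval (word_detector w) f) (e 0) (fdeg w)%:Z = word_weight w w.
  rewrite (skew_act_sum lowering_raising) fct_sumE.
  rewrite (bigD1_seq w) ?fset_uniq //= fw1 scale1r.
  rewrite word_detectorE [X in X + _]/GRing.scale /= [X in X + _]/GRing.scale /=.
  rewrite {1}/e eqxx mulr1 big1 ?addr0 // => v neq_vw.
  rewrite word_detectorE [LHS]/GRing.scale /= [LHS]/GRing.scale /=.
  rewrite [X in _ * X]/GRing.scale /= [X in _ * X]/GRing.scale /=.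
  have [eq_vw|neq] := eqVneq (size v) (size w).
    by rewrite word_weight_eq0 // ?mul0r ?mulr0.
  by rewrite /e eqz_nat eq_sym (negbTE neq) !mulr0.
rewrite f0 (skew_act0 lowering_raising) => /esym/eqP.
exact/negP/word_weight_neq0.
Qed.
End WeightedShifts.

(** * Weights *)

Lemma unit_power_order (k : fieldType) (q : k) (n : nat) :
  q != 1 -> (0 < n)%N ->
  q ^+ n = 1 -> exists2 m, (2 <= m)%N & m.-primitive_root q.
Proof.
move=> q_neq1 n_gt0 /(prim_order_exists n_gt0)[m q_prim _]; exists m => //.
move: (prim_order_gt0 q_prim) (prim_expr_order q_prim) => {q_prim}.
by case: m => [|[|m]] // _ /eqP; rewrite expr1 (negbTE q_neq1).
Qed.

Lemma injective_shift (T : Type) (f : nat -> T) :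
  (forall n d, f n = f (n + d)%N -> d = 0) -> injective f.
Proof.
move=> f_shift m n.
by case: (leqP m n) =>
    [/subnKC <- /f_shift -> | /ltnW/subnKC <- /esym/f_shift ->];
  rewrite addn0.
Qed.

Lemma injective_exprn (k : fieldType) (q : k) : q != 0 -> q != 1 ->
  ~ (exists2 m, (2 <= m)%N & m.-primitive_root q) ->
  injective (fun n => q ^+ n).
Proof.
move=> q_neq0 q_neq1 q_free.
apply: injective_shift => n d.
rewrite exprD -[LHS]mulr1 => /(mulfI (expf_neq0 n q_neq0)) /esym qd1.
by case: d qd1 => // d /(unit_power_order q_neq1 (ltn0Sn d)).
Qed.

(** The recurrence is the relation [y x = q1 x y + q4] read on the weights of
    [x y]: its solutions are arithmetic progressions when [q1 = 1] and geometric
    progressions up to a constant otherwise. *)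
Lemma weights_exist (k : fieldType) (q1 q4 : k) :
  [pchar k] =i pred0 -> q1 != 0 -> ~ (q1 = 1 /\ q4 = 0) ->
  ~ (exists2 m, (2 <= m)%N & m.-primitive_root q1) ->
  exists2 c : int -> k, (forall n : int, c (n + 1) = q1 * c n + q4) &
    injective (fun n : nat => c n%:Z).
Proof.
move=> char0 q1_neq0 noncomm q1_free; have [q1_1|q1_neq1] := eqVneq q1 1.
  have q4_neq0 : q4 != 0 by apply/eqP=> q4_0; exact: noncomm.
  exists (fun n => q4 *~ n) => [n|]; first by rewrite q1_1 mul1r mulrzDr.
  apply: injective_shift => i d /=.
  rewrite -!pmulrn mulrnDr -[LHS]addr0 => /addrI/esym/eqP.
  by rewrite -mulr_natr mulf_eq0 (negbTE q4_neq0) (pcharf0P k).1 // => /eqP.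
(* [b] is the fixed point of the recurrence, which is linear around it. *)
pose b := q4 / (1 - q1); have bE : b = q1 * b + q4.
  apply/eqP; rewrite -subr_eq0 opprD addrA -{1}[b]mul1r -mulrBl /b mulrC divfK ?subrr //.
  by rewrite subr_eq0 eq_sym.
exists (fun n => q1 ^ n + b) => [n|m n /= /addIr].
  by rewrite expfzDr // expr1z mulrDr -addrA -bE mulrC.
by rewrite -!exprnP => /(injective_exprn q1_neq0 q1_neq1 q1_free).
Qed.

(** * The standard polynomial *)

Definition update (m : nat) (T : Type) (a : 'I_m -> T) (j : 'I_m) (b : T) :
    'I_m -> T :=
  fun i => if i == j then b else a i.

Section AlternatingSum.
Variables (k : fieldType) (A : algType k) (m : nat).

Definition alt_sum (a : 'I_m -> A) : A :=
  \sum_(s : 'S_m) (-1) ^+ s *: \prod_(i < m) a (s i).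

Lemma eq_alt_sum a b : a =1 b -> alt_sum a = alt_sum b.
Proof.
by move=> eq_ab; apply: eq_bigr => s _; congr (_ *: _); apply: eq_bigr.
Qed.

(** Composing with the transposition of [i] and [j] pairs the even permutations
    with the odd ones, as for determinants. *)
Lemma alt_sum_alternate a i j : i != j -> a i = a j -> alt_sum a = 0.
Proof.
move=> neq_ij eq_a; pose t := tperm i j.
have at_ x : a (t x) = a x by rewrite /t; case: tpermP => // ->.
rewrite /alt_sum (bigID (@odd_perm _)) /= (reindex_inj (mulIg t)) /=.
rewrite -[X in _ + X]opprK; apply/eqP; rewrite subr_eq0 -sumrN; apply/eqP.
apply: eq_big => s; first by rewrite odd_permM odd_tperm neq_ij addbT.
rewrite odd_permM odd_tperm neq_ij addbT => /negbTE ->.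
rewrite /= expr1 expr0 scaleN1r scale1r; congr (- _).
by apply: eq_bigr => x _; rewrite permM at_.
Qed.

(** The letter [j] occurs once in [r], so the product is linear in the value
    put there, with the rest of the product acting on both sides. *)
Lemma prod_update (a : 'I_m -> A) j (r : seq 'I_m) : uniq r -> j \in r ->
  exists P Q, forall b, \prod_(i <- r) update a j b i = P * b * Q.
Proof.
move=> + /path.splitPr jr; case: jr => r1 r2; rewrite cat_uniq /= negb_or.
case/and3P=> _ /andP[j_r1 _] /andP[j_r2 _].
exists (\prod_(i <- r1) a i), (\prod_(i <- r2) a i) => b.
rewrite big_cat big_cons /= /update eqxx mulrA; congr (_ * _ * _);
  by rewrite big_seq [RHS]big_seq; apply: eq_bigr => i; case: eqP => // ->;
     rewrite ?(negbTE j_r1) ?(negbTE j_r2).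
Qed.

Definition central (z : A) := forall a, z * a = a * z.

Lemma alt_sum_update a j (I : finType) (z b : I -> A) :
  (forall l, central (z l)) ->
  alt_sum (update a j (\sum_l z l * b l)) =
  \sum_l z l * alt_sum (update a j (b l)).
Proof.
move=> z_central; under [RHS]eq_bigr => l _ do rewrite mulr_sumr.
rewrite exchange_big; apply: eq_bigr => s _ /=.
under [RHS]eq_bigr => l _ do rewrite -scalerAr.
rewrite -scaler_sumr; congr (_ *: _).
pose r := [seq s i | i <- index_enum 'I_m].
have prodE c : \prod_(i < m) update a j c (s i) = \prod_(i <- r) update a j c i.
  by rewrite big_map.
have uniq_r : uniq r by rewrite map_inj_uniq ?index_enum_uniq //; exact: perm_inj.
have j_r : j \in r.
  by apply/mapP; exists (s^-1%g j); rewrite ?mem_index_enum ?permKV.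
have [P [Q PQ]] := prod_update a uniq_r j_r.
rewrite prodE PQ mulr_sumr mulr_suml; apply: eq_bigr => l _.
by rewrite prodE PQ mulrA -z_central !mulrA.
Qed.

(** The alternating sum is multilinear over the centre, so its arguments may be
    replaced one at a time by members of [e]; there are fewer of these than
    arguments, so two arguments end up equal. *)
Lemma alt_sum_central_span (I : finType) (e : I -> A) : (#|I| < m)%N ->
  (forall a, exists2 z : I -> A, forall i, central (z i) &
     a = \sum_i z i * e i) ->
  forall a, alt_sum a = 0.
Proof.
move=> I_lt_m span.
suff H n a : (forall i : 'I_m, (n <= i)%N -> exists l, a i = e l) -> alt_sum a = 0.
  by move=> a; apply: (H m) => i; rewrite leqNgt ltn_ord.
(* The arguments of index at least [n] are already members of [e]. *)
elim: n a => [|n IHn] a a_e.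
  have [l a_l] := fin_all_exists (fun i => a_e i (leq0n i)).
  have [/injectiveP/leq_card|/injectivePn[i [j neq_ij eq_l]]] := boolP (injectiveb l).
    by rewrite card_ord leqNgt I_lt_m.
  by apply: (alt_sum_alternate neq_ij); rewrite !a_l eq_l.
case: (ltnP n m) => [n_lt_m|m_le_n]; last first.
  apply: IHn => i n_le_i; have := leq_trans (ltn_ord i) m_le_n.
  by rewrite ltnNge n_le_i.
pose j := Ordinal n_lt_m; have [z z_central aj] := span (a j).
rewrite (@eq_alt_sum _ (update a j (\sum_l z l * e l))); last first.
  by move=> i; rewrite /update -aj; case: eqP => [->|].
rewrite alt_sum_update // big1 // => l _; rewrite IHn ?mulr0 // => i n_le_i.
rewrite /update; case: eqP => [_|/eqP neq_ij]; first by exists l.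
by apply: a_e; rewrite ltn_neqAle n_le_i andbT eq_sym.
Qed.
End AlternatingSum.

Section StandardPolynomial.
Variables (k : fieldType) (m : nat).
Definition perm_word (s : 'S_m) : {fmonom 'I_m} :=
  FMonom [seq s i | i <- index_enum 'I_m].

Definition standard_poly : {malg k[{fmonom 'I_m}]} :=
  \sum_(s : 'S_m) << (-1) ^+ s *g perm_word s >>.

Lemma free_eval_standard (A : algType k) (a : 'I_m -> A) :
  free_eval a standard_poly = alt_sum a.
Proof.
rewrite free_eval_lin_ext linear_sum; apply: eq_bigr => s _.
by rewrite [LHS]lin_extU big_map.
Qed.

Lemma perm_word_inj : injective perm_word.
Proof.
move=> s t [/eq_in_map st]; apply/permP=> i; apply: st.
by rewrite mem_index_enum.
Qed.

Lemma mcoeff_standard s : standard_poly@_(perm_word s) = (-1) ^+ s.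
Proof.
rewrite /standard_poly (linear_sum (mcoeff (perm_word s))) (bigD1 s) //= mcoeffUU.
rewrite big1 ?addr0 // => t neq_ts; rewrite mcoeffU.
by case: eqP => [/perm_word_inj/eqP|]; rewrite ?(negbTE neq_ts).
Qed.

Lemma free_monic_standard : free_monic standard_poly.
Proof.
have supp w : w \in msupp standard_poly -> size (w : seq 'I_m) = m.
  apply: contraTeq => neq_wm; rewrite -mcoeff_eq0 /standard_poly.
  rewrite (linear_sum (mcoeff w)) big1 // => s _; rewrite [LHS]mcoeffU.
  case: eqP => // ws; case/eqP: neq_wm; rewrite -ws /= size_map.
  by rewrite -sum1_size sum1_card card_ord.
have idE : standard_poly@_(perm_word 1) = 1 by rewrite mcoeff_standard odd_perm1.
have id_supp : perm_word 1 \in msupp standard_poly.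
  by rewrite -mcoeff_neq0 idE oner_neq0.
by exists (perm_word 1); split=> // v v_supp; rewrite /fdeg !supp.
Qed.

End StandardPolynomial.

Lemma central_span_PI (k : fieldType) (A : algType k) (I : finType)
    (e : I -> A) :
  (forall a, exists2 z : I -> A, forall i, central (z i) &
     a = \sum_i z i * e i) ->
  PI_algebra A.
Proof.
move=> span; exists #|I|.+1, (standard_poly k _).
split; first exact: free_monic_standard.
move=> a; rewrite free_eval_standard.
exact: (alt_sum_central_span (ltnSn _) span).
Qed.

(** * Finiteness over the centre at a root of unity *)

Definition qint (k : fieldType) (q : k) (n : nat) : k := \sum_(i < n) q ^+ i.

Lemma qintS (k : fieldType) (q : k) n : qint q n.+1 = q * qint q n + 1.
Proof.
rewrite /qint big_ord_recl mulr_sumr addrC; congr (_ + _).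
by apply: eq_bigr => i _; rewrite exprS.
Qed.

(** [(q - 1) * qint q n = q ^+ n - 1]; this is where [n >= 2] enters, as
    [qint 1 1 = 1]. *)
Lemma qint_prim (k : fieldType) (q : k) n : (2 <= n)%N -> n.-primitive_root q ->
  qint q n = 0.
Proof.
move=> n_ge2 q_prim; have /eqP := subrX1 q n.
rewrite (prim_expr_order q_prim) subrr eq_sym mulf_eq0 subr_eq0 => /orP[/eqP q1|/eqP //].
have := prim_order_dvd q_prim 1; rewrite q1 expr1n eqxx dvdn1.
by case: n n_ge2 {q_prim} => [|[|]].
Qed.

Section QCommutation.
Variables (k : fieldType) (B : algType k) (q c : k) (x y : B).
Hypothesis yx : y * x = q *: (x * y) + c%:A.

Lemma qcommuteX i :
  y * x ^+ i = q ^+ i *: (x ^+ i * y) + (qint q i * c) *: x ^+ i.-1.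
Proof.
elim: i => [|i IHi].
  by rewrite /qint big_ord0 mul0r scale0r !expr0 scale1r mul1r mulr1 addr0.
rewrite [in LHS]exprS mulrA yx mulrDl -scalerAl -mulrA IHi mulrDr scalerDr.
rewrite -!scalerAr !scalerA mulrA -!exprS -addrA; congr (_ + _).
rewrite -scalerAl mul1r; case: i {IHi} => [|i] /=.
  rewrite /qint big_ord0 !(mul0r, mulr0) scale0r add0r big_ord_recr big_ord0 /=.
  by rewrite add0r expr0 mul1r.
by rewrite -scalerDl (qintS q i.+1) mulrA mulrDl mul1r.
Qed.

Lemma qcommuteY j :
  y ^+ j * x = q ^+ j *: (x * y ^+ j) + (qint q j * c) *: y ^+ j.-1.
Proof.
elim: j => [|j IHj].
  by rewrite /qint big_ord0 mul0r scale0r !expr0 scale1r mul1r mulr1 addr0.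
rewrite [in LHS]exprSr -mulrA yx mulrDr -scalerAr mulrA IHj mulrDl scalerDr.
rewrite -!scalerAl !scalerA -exprS -mulrA -exprSr -addrA; congr (_ + _).
rewrite -scalerAr mulr1; case: j {IHj} => [|j] /=.
  rewrite /qint big_ord0 !(mul0r, mulr0) scale0r add0r big_ord_recr big_ord0 /=.
  by rewrite add0r expr0 mul1r.
by rewrite -exprSr -scalerDl (qintS q j.+1) mulrA mulrDl mul1r.
Qed.
End QCommutation.

Section Generation.
Variables (k : fieldType) (q1 q4 : k).
Local Notation A := (skewPBW q1 q4).

Lemma skewPBW_ind (P : A -> Prop) :
  P 1 -> (forall c a b, P a -> P b -> P (c *: a + b)) ->
  (forall a, P a -> P (skewX q1 q4 * a)) ->
  (forall a, P a -> P (skewY q1 q4 * a)) -> forall a, P a.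
Proof.
move=> P1 PD PX PY a.
have P0 : P 0 by rewrite -(addNr 1) -scaleN1r; exact: PD.
have [f ->] := skew_pi_surj a; rewrite [f]monalgE raddf_sum.
apply: big_ind => // [u v Pu Pv|w _]; first by rewrite -[u]scale1r; exact: PD.
rewrite malgUZ /= skew_piZ -[_ *: _]addr0; apply: PD => //.
case: w => w; elim: w => [|i w IHw].
  by rewrite (_ : skew_pi _ _ _ = 1) // -skew_pi1; congr skew_pi; rewrite -fmoneE.
have -> : << FMonom (i :: w) >> = << fmu i >> * << FMonom w >> :> free_alg k 2.
  rewrite malgM_def fgmulUU mulr1; congr << _ >>; apply/eqP; rewrite fmP.
  by rewrite fmM fmU.
rewrite skew_piM; have [->|->] : i = ord0 \/ i = ord_max; [|exact: PX|exact: PY].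
by case: i => [[|[|]]] // ?; [left|right]; apply: val_inj.
Qed.

Lemma central_skewPBW z : z * skewX q1 q4 = skewX q1 q4 * z ->
  z * skewY q1 q4 = skewY q1 q4 * z -> central z.
Proof.
move=> zX zY; apply: skewPBW_ind => [|c a b za zb|a za|a za].
- by rewrite mul1r mulr1.
- by rewrite mulrDr mulrDl -scalerAr -scalerAl za zb.
- by rewrite mulrA zX -!mulrA za.
- by rewrite mulrA zY -!mulrA za.
Qed.
End Generation.

Section RootOfUnity.
Variables (k : fieldType) (q1 q4 : k) (n : nat).
Hypotheses (n_ge2 : (2 <= n)%N) (q1_prim : n.-primitive_root q1).
Local Notation A := (skewPBW q1 q4).
Local Notation x := (skewX q1 q4).
Local Notation y := (skewY q1 q4).

(** Moving [y] across [x ^+ n] costs [q1 ^+ n = 1] and leaves the remainder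
    [qint q1 n * q4 = 0]. *)
Lemma central_Xn : central (x ^+ n).
Proof.
apply: central_skewPBW; first by rewrite -exprSr -exprS.
rewrite (qcommuteX (skewYX q1 q4)) (qint_prim n_ge2 q1_prim) mul0r scale0r addr0.
by rewrite (prim_expr_order q1_prim) scale1r.
Qed.

Lemma central_Yn : central (y ^+ n).
Proof.
apply: central_skewPBW; last by rewrite -exprSr -exprS.
rewrite (qcommuteY (skewYX q1 q4)) (qint_prim n_ge2 q1_prim) mul0r scale0r addr0.
by rewrite (prim_expr_order q1_prim) scale1r.
Qed.

Lemma centralM (B : algType k) (z t : B) :
  central z -> central t -> central (z * t).
Proof. by move=> zc tc a; rewrite -mulrA tc mulrA zc mulrA. Qed.

Lemma centralX (B : algType k) (z : B) i : central z -> central (z ^+ i).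
Proof.
move=> zc; elim: i => [|i IHi]; first by move=> a; rewrite mul1r mulr1.
by rewrite exprS; exact: centralM.
Qed.

Let e (ij : 'I_n * 'I_n) : A := x ^+ ij.1 * y ^+ ij.2.
Let spanned (a : A) :=
  exists2 z, forall ij, central (z ij) & a = \sum_ij z ij * e ij.

Let spannedP c a b : spanned a -> spanned b -> spanned (c *: a + b).
Proof.
case=> [z zc ->] [t tc ->]; exists (fun ij => c *: z ij + t ij) => [ij d|].
  by rewrite mulrDl mulrDr -scalerAl -scalerAr zc tc.
rewrite scaler_sumr -big_split; apply: eq_bigr => ij _ /=.
by rewrite mulrDl scalerAl.
Qed.

Let spanned0 : spanned 0.
Proof.
exists (fun=> 0) => [ij d|]; first by rewrite mul0r mulr0.
by rewrite big1 // => ij _; rewrite mul0r.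
Qed.

Let spanned_sum I (r : seq I) (a : I -> A) :
  (forall i, spanned (a i)) -> spanned (\sum_(i <- r) a i).
Proof.
move=> a_s; apply: big_ind => // u v us vs; rewrite -[u]scale1r; exact: spannedP.
Qed.

Let spannedM z a : central z -> spanned a -> spanned (z * a).
Proof.
move=> zc [t tc ->]; exists (fun ij => z * t ij) => [ij|]; first exact: centralM.
by rewrite mulr_sumr; apply: eq_bigr => ij _; rewrite mulrA.
Qed.

Let n_gt0 : (0 < n)%N. Proof. exact: ltnW. Qed.

Let spanned_monomial i j : spanned (x ^+ i * y ^+ j).
Proof.
pose r := (Ordinal (ltn_pmod i n_gt0), Ordinal (ltn_pmod j n_gt0)).
have -> : x ^+ i * y ^+ j = ((x ^+ n) ^+ (i %/ n) * (y ^+ n) ^+ (j %/ n)) * e r.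
  rewrite {1}(divn_eq i n) {1}(divn_eq j n) /e /= !exprD !(mulnC _ n) !exprM.
  rewrite -!mulrA; congr (_ * _); rewrite !mulrA; congr (_ * _).
  by rewrite (centralX _ central_Yn).
apply: spannedM.
  by apply: centralM; apply: centralX; [exact: central_Xn|exact: central_Yn].
exists (fun ij => (ij == r)%:R) => [ij a|].
  by case: (ij == r); rewrite ?(mul1r, mulr1, mul0r, mulr0).
rewrite (bigD1 r) //= eqxx mul1r big1 ?addr0 // => ij /negbTE ->.
by rewrite mul0r.
Qed.

(** [A] is a finite module over its centre: [x ^+ n] and [y ^+ n] absorb the
    quotients of the exponents by [n], and the span is stable under left
    multiplication by both generators. *)
Lemma skewPBW_spanned a : spanned a.
Proof.
elim/skewPBW_ind: a => [||a [z zc ->]|a [z zc ->]].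
- by have := spanned_monomial 0 0; rewrite !expr0 mulr1.
- exact: spannedP.
- rewrite mulr_sumr; apply: spanned_sum => ij; rewrite mulrA -zc -mulrA.
  by apply: spannedM => //; rewrite /e mulrA -exprS.
rewrite mulr_sumr; apply: spanned_sum => ij; rewrite mulrA -zc -mulrA.
apply: spannedM => //; rewrite /e mulrA (qcommuteX (skewYX q1 q4)) mulrDl.
rewrite -!scalerAl -mulrA -exprS; apply: spannedP; first exact: spanned_monomial.
rewrite -[_ *: _]addr0; apply: spannedP => //; exact: spanned_monomial.
Qed.

Lemma skew_PI : PI_algebra A.
Proof. exact: central_span_PI skewPBW_spanned. Qed.
End RootOfUnity.

(** * The characterization *)

Theorem theorem2p19 (k : fieldType) (q1 q4 : k)
    (char0 : [pchar k] =i pred0) (q1_neq0 : q1 != 0)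
    (A_noncomm : ~ (q1 = 1 /\ q4 = 0)) :
  PI_algebra (skewPBW q1 q4) <->
  exists2 n : nat, (2 <= n)%N & n.-primitive_root q1.
Proof.
split=> [A_PI|[n n_ge2 q1_prim]]; last exact: skew_PI n_ge2 q1_prim.
apply: contrapT => q1_free.
have [c cS c_inj] := weights_exist char0 q1_neq0 A_noncomm q1_free.
exact: skew_not_PI cS c_inj A_PI.
Qed.
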